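(* Let $M(n)$ be a matrix whose entries are functions of $n$ in $\mathrm{IQ}$. Then both the upper triangular matrix and the unimodular multiplier in the Hermite normal form of $M(n)$ have entries eventually in $\mathrm{IQ}$. That is, there are matrices $B(n)$ and $U(n)$, whose entries are functions of $n$ agreeing with elements of $\mathrm{IQ}$ for $n\gg 0$, such that for all sufficiently large $n$ the matrix $U(n)$ is integral and unimodular, $B(n)$ is in Hermite normal form, and $M(n)=U(n)B(n)$.
   Context: An (integral) quasipolynomial is a function $p:\mathbb{N}\to\mathbb{Z}$ for which there are a least positive integer $\pi$ (its period) and polynomials $p_0,\dots,p_{\pi-1}\in\mathbb{Z}[n]$ with $p(n)=p_{n \bmod \pi}(n)$ for all $n\in\mathbb{N}$. A function $q:\mathbb{N}\to\mathbb{Z}$ is in the class $\mathrm{IQ}$ if $q(n)=p(n)/C$, where $p$ is an integral quasipolynomial and $C$ is a constant (nonzero) integer such that $C$ divides $p(n)$ for all $n\ge 0$. Hermite normal form: a (not necessarily square) integral matrix is in Hermite normal form if it is upper triangular, and if the entries are all non-negative and, in each column, maximized on the diagonal (strictly maximized if nonzero). The Hermite normal form of an integral matrix $M$ refers to a factorization $M=UB$ with $U$ a unimodular integral matrix (the unimodular multiplier) and $B$ in Hermite normal form (the upper triangular matrix). The source recalls as a known fact that for an arbitrary integral matrix $M$ such a factorization exists, with $B$ unique given $M$, though $U$ might not be. It also remarks that the usual case of interest is that of an $r\times m$ matrix of rank $m$ with $m\le r$.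
   Formalization: The Hermite normal form as defined need not exist when M(n) has rank below its number of columns, e.g. ((1,-1),(0,0)); there B(n) is in the standard row-echelon Hermite form (pivots replace the diagonal), while for full column rank B(n) is in the form as defined. *)

(* Defs.v *)
From HB Require Import structures.
From mathcomp Require Import all_boot all_order all_algebra.

Set Implicit Arguments.
Unset Strict Implicit.
Unset Printing Implicit Defensive.

Import Order.TTheory GRing.Theory Num.Theory.
Local Open Scope ring_scope.

(* The period is the least admissible [d]; it exists as soon as some positive
   [d] does. Only the values [P 0], ..., [P d.-1] are used. *)
Definition quasipolynomial (p : nat -> int) : Prop :=
  exists (d : nat) (P : nat -> {poly int}),
    (0 < d)%N /\ forall n : nat, p n = (P (n %% d)%N).[n%:Z].

Definition IQ (q : nat -> int) : Prop :=
  exists (p : nat -> int) (C : int),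
    [/\ quasipolynomial p, C != 0,
        forall n : nat, (C %| p n)%Z &
        forall n : nat, q n = (p n %/ C)%Z].

Definition eventually (P : nat -> Prop) : Prop :=
  exists N : nat, forall n : nat, (N <= n)%N -> P n.

Definition eventually_IQ (f : nat -> int) : Prop :=
  exists q : nat -> int, IQ q /\ eventually (fun n => f n = q n).

(* Hermite normal form read off the main diagonal. Every matrix of full column
   rank has exactly one such form up to left multiplication by a unimodular
   matrix, but other matrices may have none: ((1, -1), (0, 0)) does not, since
   a column with diagonal entry 0 would have to vanish. *)
Definition hermite_normal_form (r m : nat) (B : 'M[int]_(r, m)) : Prop :=
  [/\ forall (i : 'I_r) (j : 'I_m), (j < i)%N -> B i j = 0,
      forall (i : 'I_r) (j : 'I_m), 0 <= B i j &
      forall (k : 'I_r) (j : 'I_m), k = j :> nat ->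
        forall i : 'I_r,
          B i j <= B k j /\ (B k j != 0 -> i != k -> B i j < B k j)].

Definition pivot (r m : nat) (B : 'M[int]_(r, m)) (i : 'I_r) (j : 'I_m) : Prop :=
  B i j != 0 /\ forall j' : 'I_m, (j' < j)%N -> B i j' = 0.

(* Hermite normal form of an integral matrix of arbitrary shape and rank: the
   pivots of a row echelon form play the role of the diagonal. The first clause
   says that the pivots move strictly to the right from one row to the next and
   that the zero rows come last. In full column rank the pivots are exactly the
   diagonal entries, and this agrees with [hermite_normal_form]. *)
Definition hermite_echelon_form (r m : nat) (B : 'M[int]_(r, m)) : Prop :=
  (forall (i i' : 'I_r) (j' : 'I_m), (i < i')%N -> pivot B i' j' ->
     exists2 j : 'I_m, (j < j')%N & pivot B i j) /\
  (forall (i : 'I_r) (j : 'I_m), pivot B i j ->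
     0 < B i j /\ forall i' : 'I_r, i' != i -> 0 <= B i' j < B i j).

Definition full_column_rank (r m : nat) (A : 'M[int]_(r, m)) : Prop :=
  \rank (map_mx (intr : int -> rat) A) = m.

(* Main.v *)
Require Import Defs.
From HB Require Import structures.
From mathcomp Require Import all_boot all_order all_algebra.
From mathcomp Require Import zify ring.

Set Implicit Arguments.
Unset Strict Implicit.
Unset Printing Implicit Defensive.

Import Order.TTheory GRing.Theory Num.Theory.
Local Open Scope ring_scope.

(* A function that is polynomial on residue classes can be studied one class at
   a time, and along n = e k + c an integer polynomial stays one. If
   deg P > deg Q, then along n = |lc Q| k + c the leading coefficient of P
   becomes divisible by that of Q, so the leading term of P can be cancelled by
   an integral multiple of Q without changing the degree of Q; if the degrees
   agree, division of the leading coefficients decreases the leading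
   coefficient. Hence Euclid's algorithm terminates uniformly in n: floor
   quotients and Bezout matrices are again piecewise polynomial. Row reduction,
   column by column, then yields the Hermite form; in IQ the division by C needs
   no separate treatment, being one of these floor quotients. *)

(** * Eventual properties and residue classes *)

Lemma eventually_all (P : nat -> Prop) : (forall n, P n) -> eventually P.
Proof. by move=> H; exists 0%N. Qed.

Lemma eventually_mono (P Q : nat -> Prop) :
  (forall n, P n -> Q n) -> eventually P -> eventually Q.
Proof. by move=> PQ [N HN]; exists N => n /HN /PQ. Qed.

Lemma eventually_and (P Q : nat -> Prop) :
  eventually P -> eventually Q -> eventually (fun n => P n /\ Q n).
Proof.
move=> [N HN] [N' HN']; exists (maxn N N') => n.
by rewrite geq_max => /andP[/HN ? /HN' ?].
Qed.

Lemma eventually_progression (P : nat -> Prop) d c :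
  (0 < d)%N -> eventually P -> eventually (fun k => P (d * k + c)%N).
Proof.
move=> d0 [N HN]; exists N => k kN; apply: HN.
by rewrite (leq_trans kN)// (leq_trans (leq_pmull k d0)) ?leq_addr.
Qed.

(** There are finitely many classes, so the maximum of their thresholds, rescaled by [d], gives a
    threshold for all [n]. *)
Lemma eventually_split (P : nat -> Prop) d : (0 < d)%N ->
  (forall c : 'I_d, eventually (fun k => P (d * k + c)%N)) -> eventually P.
Proof.
move=> d0 /fin_all_exists[N HN]; exists (d * \max_c N c + d)%N => n nN.
have cd : (n %% d < d)%N by rewrite ltn_mod.
rewrite (divn_eq n d) mulnC; apply: (HN (Ordinal cd)).
apply: leq_trans (leq_bigmax (Ordinal cd)) _.
rewrite leq_divRL// mulnC; apply: leq_trans nN; exact: leq_addr.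
Qed.

(** Induction through P X + c: a positive integer P(n) is at least 1, so P(n) n + c >= n + c, which
    is positive once n > |c|. *)
Lemma horner_eventually_gt0 (P : {poly int}) : 0 < lead_coef P ->
  eventually (fun n => 0 < P.[n%:Z]).
Proof.
elim/poly_ind: P => [|P c IH]; first by rewrite lead_coef0 ltxx.
case: (eqVneq P 0) => [->|P0].
  rewrite mul0r add0r lead_coefC => c0; apply: eventually_all => n.
  by rewrite hornerC.
rewrite lead_coefDl; last first.
  by rewrite size_mulX// ltnS (leq_trans (size_polyC_leq1 _))// size_poly_gt0.
rewrite lead_coefMX => /IH[N HN].
exists (N + `|c| + 1)%N => n nN; rewrite !hornerE.
have {}HN : 0 < P.[n%:Z] by apply: HN; lia.
suff aux (v k : int) : 0 < v -> (`|k| < n)%N -> 0 < v * n%:Z + k.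
  by apply: aux => //; lia.
by move=> v1; have := ler_peMl (le0z_nat n) (v1 : 1 <= v); lia.
Qed.

Lemma sgz_horner (P : {poly int}) :
  eventually (fun n => sgz (lead_coef P) = sgz P.[n%:Z]).
Proof.
have [P0|P0|/eqP] := ltrgt0P (lead_coef P).
- apply: eventually_mono (horner_eventually_gt0 P0) => n /gtr0_sgz ->.
  by rewrite gtr0_sgz.
- have : 0 < lead_coef (- P) by rewrite lead_coefN oppr_gt0.
  move=> /horner_eventually_gt0; apply: eventually_mono => n.
  by rewrite hornerN oppr_gt0 => /ltr0_sgz ->; rewrite ltr0_sgz.
- rewrite lead_coef_eq0 => /eqP ->; apply: eventually_all => n.
  by rewrite lead_coef0 horner0.
Qed.

(** Composing with this polynomial restricts to a residue class, the position in the class being the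
    new variable. *)
Definition progression (d c : nat) : {poly int} := d%:Z *: 'X + c%:Z%:P.

Lemma horner_progression d c (P : {poly int}) (k : nat) :
  (P \Po progression d c).[k%:Z] = P.[(d * k + c)%N%:Z].
Proof. by rewrite horner_comp !hornerE; congr (_.[_]); lia. Qed.

Lemma size_progression d c : (0 < d)%N -> size (progression d c) = 2%N.
Proof.
move=> d0; have dZ : d%:Z != 0 by lia.
rewrite /progression size_polyDl size_scale ?size_polyX//.
by rewrite ltnS size_polyC_leq1.
Qed.

Lemma lead_coef_progression d c : (0 < d)%N -> lead_coef (progression d c) = d%:Z.
Proof.
move=> d0; have dZ : d%:Z != 0 by lia.
rewrite /progression lead_coefDl ?lead_coefZ ?lead_coefX ?mulr1//.
by rewrite size_scale ?size_polyX// ltnS size_polyC_leq1.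
Qed.

Lemma size_comp_progression d c (P : {poly int}) : (0 < d)%N ->
  size (P \Po progression d c) = size P.
Proof. by move=> d0; rewrite size_comp_poly2 ?size_progression. Qed.

Lemma lead_coef_comp_progression d c (P : {poly int}) : (0 < d)%N ->
  lead_coef (P \Po progression d c) = lead_coef P * d%:Z ^+ (size P).-1.
Proof.
by move=> d0; rewrite lead_coef_comp ?size_progression// lead_coef_progression.
Qed.

(** * Eventually piecewise polynomial functions *)

(** Splittings may be nested, with moduli that differ from class to class, so an algorithm can keep
    refining without a common period; [epp_periodic] extracts one at the end. *)
Inductive eventually_piecewise_poly : (nat -> int) -> Prop :=
| EppPoly f (P : {poly int}) of eventually (fun n => f n = P.[n%:Z]) :
    eventually_piecewise_poly f
| EppSplit f d of (0 < d)%N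
    & (forall c : 'I_d,
         eventually_piecewise_poly (fun k => f (d * k + c)%N)) :
    eventually_piecewise_poly f.

Local Notation epp := eventually_piecewise_poly.

Lemma epp_eventually_eq f g :
  eventually (fun n => f n = g n) -> epp f -> epp g.
Proof.
move=> + ef; elim: ef g => {}f.
  move=> P fP g fg; apply: (EppPoly (P := P)).
  by apply: eventually_mono (eventually_and fP fg) => n [<- <-].
move=> d d0 _ IH g fg; apply: (EppSplit d0) => c; apply: (IH c).
exact: eventually_progression fg.
Qed.

Lemma epp_eq f g : f =1 g -> epp f -> epp g.
Proof. by move=> fg; apply: epp_eventually_eq; apply: eventually_all. Qed.

Lemma epp_progression f d c : (0 < d)%N -> epp f ->
  epp (fun k => f (d * k + c)%N).
Proof.
move=> d0 ef; elim: ef c => {}f.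
  move=> P fP c; apply: (EppPoly (P := P \Po progression d c)).
  apply: eventually_mono (eventually_progression c d0 fP) => n ->.
  by rewrite horner_progression.
(* With s = d b + c and floor quotients, d (e k + b) + c = e (d k + s / e) + (s mod e), so each
   subclass lies in one class of the given splitting. *)
move=> e e0 _ IH c; apply: (EppSplit e0) => b.
have re : ((d * b + c) %% e < e)%N by rewrite ltn_mod.
apply: epp_eq (IH (Ordinal re) ((d * b + c) %/ e)%N) => k /=.
congr f; rewrite mulnDr -addnA [(e * (_ %/ e))%N]mulnC -divn_eq; lia.
Qed.

Lemma epp_ind1 (Phi : (nat -> int) -> Prop) :
  (forall f d, (0 < d)%N ->
     (forall c : 'I_d, Phi (fun k => f (d * k + c)%N)) -> Phi f) ->
  (forall f (P : {poly int}), eventually (fun n => f n = P.[n%:Z]) -> Phi f) ->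
  forall f, epp f -> Phi f.
Proof.
move=> Hs Hp f ef; elim: ef => {}f; first by move=> P; apply: Hp.
by move=> d d0 _; apply: Hs.
Qed.

(** Common refinement of two splittings: that of [f] is followed first, with [g] restricted along
    it, then that of [g], with [f] already polynomial. *)
Lemma epp_ind2 (Phi : (nat -> int) -> (nat -> int) -> Prop) :
  (forall f g d, (0 < d)%N ->
     (forall c : 'I_d, Phi (fun k => f (d * k + c)%N)
                           (fun k => g (d * k + c)%N)) -> Phi f g) ->
  (forall f g (P Q : {poly int}), eventually (fun n => f n = P.[n%:Z]) ->
     eventually (fun n => g n = Q.[n%:Z]) -> Phi f g) ->
  forall f g, epp f -> epp g -> Phi f g.
Proof.
move=> Hs Hp f g ef; elim: ef g => {}f; last first.
  move=> d d0 _ IH g eg; apply: (Hs _ _ d d0) => c; apply: IH.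
  exact: epp_progression.
move=> P fP g eg; elim: eg f P fP => {}g.
  by move=> Q gQ f P fP; apply: Hp fP gQ.
move=> d d0 _ IH f P fP; apply: (Hs _ _ d d0) => c.
apply: (IH c _ (P \Po progression d c)).
apply: eventually_mono (eventually_progression c d0 fP) => n ->.
by rewrite horner_progression.
Qed.

Lemma epp_horner (P : {poly int}) : epp (fun n => P.[n%:Z]).
Proof. by apply: (EppPoly (P := P)); apply: eventually_all. Qed.

Lemma epp_const c : epp (fun=> c).
Proof.
by apply: (EppPoly (P := c%:P)); apply: eventually_all => n; rewrite hornerC.
Qed.

Lemma epp_add f g : epp f -> epp g -> epp (fun n => f n + g n).
Proof.
move: f g; apply: epp_ind2 => [f g d d0 H|f g P Q fP gQ].
  exact: (EppSplit d0).
apply: (EppPoly (P := P + Q)).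
by apply: eventually_mono (eventually_and fP gQ) => n [-> ->]; rewrite hornerD.
Qed.

Lemma epp_mul f g : epp f -> epp g -> epp (fun n => f n * g n).
Proof.
move: f g; apply: epp_ind2 => [f g d d0 H|f g P Q fP gQ].
  exact: (EppSplit d0).
apply: (EppPoly (P := P * Q)).
by apply: eventually_mono (eventually_and fP gQ) => n [-> ->]; rewrite hornerM.
Qed.

Lemma epp_opp f : epp f -> epp (fun n => - f n).
Proof.
move=> ef; apply: epp_eq (epp_mul (epp_const (-1)) ef) => n.
by rewrite mulN1r.
Qed.

Lemma epp_sgz f : epp f -> epp (fun n => sgz (f n)).
Proof.
move: f; apply: epp_ind1 => [f d d0 H|f P fP]; first exact: (EppSplit d0).
apply: epp_eventually_eq (epp_const (sgz (lead_coef P))).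
by apply: eventually_mono (eventually_and fP (sgz_horner P)) => n [->].
Qed.

(** The square of [sgz (f n)] is the indicator of f(n) being nonzero, so the conditional equals g +
    sgz(f)^2 (h - g). *)
Lemma epp_if0 f g h : epp f -> epp g -> epp h ->
  epp (fun n => if f n == 0 then g n else h n).
Proof.
move=> ef eg eh.
have e2 : epp (fun n => sgz (f n) * sgz (f n)) by apply: epp_mul; apply: epp_sgz.
apply: epp_eq (epp_add eg (epp_mul e2 (epp_add eh (epp_opp eg)))) => n /=.
have [->|fn0] := eqVneq (f n) 0; first by rewrite sgz0 !mul0r addr0.
by rewrite mulz_sg fn0 mul1r addrC subrK.
Qed.

(** * Elimination of leading terms *)

Lemma size_sub_lead (p q : {poly int}) : p != 0 -> size q = size p ->
  lead_coef q = lead_coef p -> (size (p - q)%R < size p)%N.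
Proof.
rewrite -size_poly_gt0 => p0 eqs eql.
rewrite -(prednK p0) ltnS; apply/leq_sizeP => j.
rewrite leq_eqVlt coefB => /predU1P[<-|ltj].
  by move: eql; rewrite !lead_coefE eqs => ->; rewrite subrr.
have lj : (size p <= j)%N by rewrite -(prednK p0).
by rewrite !nth_default ?subrr// eqs.
Qed.

(** Let t = deg P - deg Q and e = |lc Q|. Composition multiplies lc P by a power of e that exceeds
    the one for lc Q by e^t; as t > 0, one factor e is available to absorb lc Q. *)
Lemma lead_term_elim (P Q : {poly int}) (c : nat) :
  Q != 0 -> (size Q < size P)%N ->
  let A := progression `|lead_coef Q|%N c in
  exists q : {poly int}, (size (P \Po A - q * (Q \Po A))%R < size P)%N.
Proof.
move=> Q0 sQP A; set e := `|lead_coef Q|%N in A *.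
have e0 : (0 < e)%N by rewrite absz_gt0 lead_coef_eq0.
have P0 : P != 0 by rewrite -size_poly_gt0 (leq_ltn_trans _ sQP).
have sQ : (0 < size Q)%N by rewrite size_poly_gt0.
pose t := (size P - size Q)%N.
(* The exact quotient of the two leading coefficients after composition: a lc(Q) = lc(P) e^t,
   because sgz(lc Q) lc(Q) = e. *)
pose a := sgz (lead_coef Q) * lead_coef P * e%:Z ^+ t.-1.
have a0 : a != 0.
  rewrite !mulf_neq0 ?sgz_eq0 ?lead_coef_eq0 ?expf_neq0//.
  by rewrite -lt0n.
have sA : size (Q \Po A) = size Q by apply: size_comp_progression.
have Qe : sgz (lead_coef Q) * lead_coef Q = e%:Z.
  by rewrite /e abszEsg.
exists (a *: 'X^t).
rewrite -[X in (_ < X)%N](size_comp_progression c P e0).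
have aX : size (a *: 'X^t * (Q \Po A)) = size P.
  rewrite -scalerAl size_scale// mulrC size_mulXn ?sA.
    by rewrite /t subnK// ltnW.
  by rewrite -size_poly_gt0 sA.
apply: size_sub_lead.
- by rewrite -size_poly_gt0 size_comp_progression// size_poly_gt0.
- by rewrite aX size_comp_progression.
- rewrite lead_coefM lead_coefZ lead_coefXn mulr1.
  rewrite !lead_coef_comp_progression//.
  have -> : (size P).-1 = (t.-1 + (size Q).-1).+1 by rewrite /t; lia.
  by rewrite exprS exprD -[X in _ = _ * (X * _)]Qe /a; ring.
Qed.

(** Dividing the coefficients in degree deg Q leaves a remainder in [0, |lc Q|): if it is 0 the size
    drops, otherwise it is the new leading coefficient. If deg P < deg Q, then q = 0. *)
Lemma lead_coef_divz (P Q : {poly int}) : Q != 0 -> (size P <= size Q)%N ->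
  exists (q : int) (R : {poly int}), P = q *: Q + R /\
    ((size R < size Q)%N \/ size R = size Q /\ 0 < lead_coef R < `|lead_coef Q|).
Proof.
move=> Q0 sPQ; set k := (size Q).-1; pose q := (P`_k %/ Q`_k)%Z.
exists q, (P - q *: Q); split; first by rewrite addrC subrK.
set R := P - q *: Q.
have lQ : lead_coef Q = Q`_k by [].
have Qk : Q`_k != 0 by rewrite -lQ lead_coef_eq0.
have sR : (size R <= size Q)%N.
  apply: leq_trans (size_polyD _ _) _; rewrite geq_max sPQ size_polyN.
  exact: size_scale_leq.
have Rk : R`_k = (P`_k %% Q`_k)%Z.
  by rewrite coefB coefZ {1}(divz_eq P`_k Q`_k) addrAC subrr add0r.
have [eqs|nes] := eqVneq (size R) (size Q); last by left; rewrite ltn_neqAle nes.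
right; split=> //; have lR : lead_coef R = R`_k by rewrite lead_coefE eqs.
have R0 : R`_k != 0.
  by rewrite -lR lead_coef_eq0 -size_poly_gt0 eqs size_poly_gt0.
by rewrite lR lQ lt_def R0 Rk modz_ge0// ltz_mod.
Qed.

(** * Floor quotients *)

Lemma lead_coef_gt0 (p : {poly int}) k :
  (size p <= k.+1)%N -> 0 < p`_k -> 0 < lead_coef p.
Proof.
move=> sp pk; have kp : (k < size p)%N.
  by rewrite ltnNge; apply: contraTN pk => /leq_sizeP/(_ k (leqnn _)) ->.
have sk : size p = k.+1 by apply/eqP; rewrite eqn_leq sp kp.
by rewrite lead_coefE sk.
Qed.

(** The hypotheses mean |x| < y, in the form in which positivity of Q - R and Q + R supplies it; x /
    y then has floor 0 or -1 by the sign of x. *)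
Lemma divzMDl_lt_norm (q x y : int) : 0 < y - x -> 0 < y + x ->
  ((q * y + x) %/ y)%Z = q - (x < 0)%R%:Z.
Proof.
move=> yx1 yx2; have y0 : y != 0 by lia.
case: ltrP => x0 /=.
  have -> : q * y + x = (q - 1) * y + (x + y) by ring.
  by rewrite divzMDl// divz_small ?addr0//; lia.
by rewrite divzMDl// divz_small ?subr0 ?addr0//; lia.
Qed.

(** Induction on the size of P. If deg P <= deg Q, then P = q Q + R with |R(n)| < Q(n) for large n,
    so the quotient is eventually q or q - 1 by the sign of lc R. Otherwise, on each class modulo lc
    Q, subtracting some q Q lowers the degree of P and the quotient by q. *)
Lemma epp_divz_horner (P Q : {poly int}) : 0 < lead_coef Q ->
  epp (fun n => (P.[n%:Z] %/ Q.[n%:Z])%Z).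
Proof.
have [s] := ubnP (size P); elim: s P Q => // s IH P Q; rewrite ltnS => sPs lQ.
have Q0 : Q != 0 by rewrite -lead_coef_eq0 gt_eqF.
have [sPQ|sQP] := leqP (size P) (size Q).
  have [q [R [-> HR]]] := lead_coef_divz Q0 sPQ.
  have sQ : (0 < size Q)%N by rewrite size_poly_gt0.
  have sR : (size R <= size Q)%N by case: HR => [/ltnW|[->]].
  have cR : `|R`_(size Q).-1| < Q`_(size Q).-1.
    case: HR => [sRQ|[sRQ /andP[lR0 lR]]].
      by rewrite nth_default ?normr0 -?lead_coefE// -ltnS prednK.
    by move: lR lR0; rewrite (gtr0_norm lQ) !lead_coefE sRQ => + /gtr0_norm ->.
  move: cR; rewrite ltr_norml => /andP[cR1 cR2].
  have QR : 0 < lead_coef (Q - R).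
    apply: (@lead_coef_gt0 _ (size Q).-1); last by rewrite coefB subr_gt0.
    by rewrite prednK// (leq_trans (size_polyD _ _))// size_polyN geq_max leqnn.
  have QR' : 0 < lead_coef (Q + R).
    apply: (@lead_coef_gt0 _ (size Q).-1); last first.
      by rewrite coefD addrC -[Q`_ _]opprK subr_gt0.
    by rewrite prednK// (leq_trans (size_polyD _ _))// geq_max leqnn.
  apply: (epp_eventually_eq _ (epp_const (q - (lead_coef R < 0)%R%:Z))).
  have := eventually_and (sgz_horner R) (eventually_and
    (horner_eventually_gt0 QR) (horner_eventually_gt0 QR')).
  apply: eventually_mono => n [sR' []]; rewrite !(hornerD, hornerN, hornerZ).
  move=> QR1 QR2; rewrite divzMDl_lt_norm//.
  by rewrite -sgz_lt0 sR' sgz_lt0.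
have e0 : (0 < `|lead_coef Q|)%N by lia.
apply: (@EppSplit _ _ e0) => c; have [q] := lead_term_elim c Q0 sQP.
set A := progression _ c; set P' := _ - _ => sP'.
have lQ' : 0 < lead_coef (Q \Po A).
  by rewrite lead_coef_comp_progression// mulr_gt0// exprn_gt0//; lia.
apply: epp_eventually_eq (epp_add (epp_horner q) (IH P' _ (leq_trans sP' sPs) lQ')).
apply: eventually_mono (horner_eventually_gt0 lQ') => k Qk.
rewrite -!horner_progression -/A -divzMDl ?gt_eqF//.
by rewrite hornerD hornerN hornerM addrC subrK.
Qed.

Lemma epp_divz f g : epp f -> epp g -> epp (fun n => (f n %/ g n)%Z).
Proof.
move: f g; apply: epp_ind2 => [f g d d0 H|f g P Q fP gQ].
  exact: (EppSplit d0).
suff e : epp (fun n => (P.[n%:Z] %/ Q.[n%:Z])%Z).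
  apply: epp_eventually_eq e.
  by apply: eventually_mono (eventually_and fP gQ) => n [-> ->].
(* Changing the sign of the divisor negates the quotient; division by 0 has value 0 by
   convention. *)
have [Q0|Q0|/eqP] := ltrgt0P (lead_coef Q); first exact: epp_divz_horner.
  have := @epp_divz_horner P (- Q); rewrite lead_coefN oppr_gt0 => /(_ Q0).
  by move=> /epp_opp; apply: epp_eq => n /=; rewrite hornerN divzN opprK.
rewrite lead_coef_eq0 => /eqP ->; apply: epp_eq (epp_const 0) => n.
by rewrite horner0 divz0.
Qed.

(** * Passage between IQ and piecewise polynomial functions *)

Lemma epp_quasipolynomial p : quasipolynomial p -> epp p.
Proof.
move=> [d [P [d0 pP]]]; apply: (EppSplit d0) => c.
apply: epp_eq (epp_horner (P c \Po progression d c)) => k.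
by rewrite horner_progression pP mulnC modnMDl modn_small.
Qed.

Lemma epp_IQ q : IQ q -> epp q.
Proof.
move=> [p [C [/epp_quasipolynomial ep _ _ qp]]].
by apply: epp_eq (epp_divz ep (epp_const C)) => n; rewrite qp.
Qed.

(** Flattens the nested splittings. The polynomials are taken in the floor quotient n / d instead of
    n, which keeps their coefficients integral. *)
Lemma epp_periodic f : epp f -> exists d (P : nat -> {poly int}),
  (0 < d)%N /\ eventually (fun n => f n = (P (n %% d)%N).[(n %/ d)%N%:Z]).
Proof.
elim=> {}f; first by move=> P fP; exists 1%N, (fun=> P); split=> //;
  apply: eventually_mono fP => n; rewrite divn1.
move=> d d0 _ /fin_all_exists[e /fin_all_exists[P IH]].
pose D := (\prod_c e c)%N; have D0 : (0 < D)%N.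
  by apply: prodn_gt0 => c; case: (IH c).
pose c_ r : 'I_d := Ordinal (ltn_pmod r d0).
(* Let r = n mod d D, k = n / d and K = n / (d D), with floor quotients. Then k = D K + r / d; as e
   divides D, k and r / d agree modulo e, and k / e = (D / e) K + (r / d) / e. *)
exists (d * D)%N, (fun r => P (c_ r) ((r %/ d) %% e (c_ r))%N \Po
  progression (D %/ e (c_ r)) (r %/ d %/ e (c_ r))).
split; first by rewrite muln_gt0 d0.
apply: (eventually_split d0) => c; have [ec0 fc] := IH c.
apply: eventually_mono fc => k ->.
rewrite horner_progression.
have eD : (e c %| D)%N by rewrite /D (bigD1 c)//= dvdn_mulr.
set r := ((d * k + c) %% (d * D))%N.
have rdD : (r = d * (k %% D) + c)%N.
  rewrite /r {1}(divn_eq k D) mulnDr -addnA mulnCA modnMDl modn_small//.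
  have := ltn_pmod k D0; have := ltn_ord c; nia.
have -> : c_ r = c.
  by apply: val_inj; rewrite /= rdD mulnC modnMDl modn_small.
have -> : (r %/ d = k %% D)%N by rewrite rdD mulnC divnMDl// divn_small ?addn0.
have -> : ((d * k + c) %/ (d * D) = k %/ D)%N.
  by rewrite divnMA mulnC divnMDl// [(c %/ d)%N]divn_small ?addn0.
rewrite modn_dvdm//; congr (_.[_%:Z]).
by rewrite {1}(divn_eq k D) -{2}(divnK eD) mulnA divnMDl// mulnC.
Qed.

(** On the class of c modulo d the value is P_c((n - c) / d); the constant C = d^t, with t at least
    the size of every P_c, clears the denominators. *)
Lemma epp_eventually_IQ f : epp f -> eventually_IQ f.
Proof.
move=> /epp_periodic[d [P [d0 fP]]].
exists (fun n => (P (n %% d)%N).[(n %/ d)%N%:Z]); split=> //.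
pose t := (\max_(c < d) size (P c))%N.
have dt : d%:Z ^+ t != 0 by rewrite expf_neq0//; lia.
exists (fun n => (P (n %% d)%N).[(n %/ d)%N%:Z] * d%:Z ^+ t), (d%:Z ^+ t).
split=> //; last 2 first.
- by move=> n; rewrite dvdz_mull.
- by move=> n; rewrite mulzK.
(* The expansion of d^t P_c((X - c) / d); [t - i] does not truncate, as i < size P_c <= t. *)
pose Q c := \sum_(i < size (P c))
  ((P c)`_i * d%:Z ^+ (t - i)) *: ('X - c%:Z%:P) ^+ i.
exists d, Q; split=> // n; set c := (n %% d)%N.
have ct : (size (P c) <= t)%N.
  by apply: (leq_bigmax (Ordinal (ltn_pmod n d0))).
rewrite /Q horner_sum horner_coef mulr_suml; apply: eq_bigr => i _.
have it : (i <= t)%N by apply: leq_trans ct; apply: ltnW.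
rewrite !hornerE.
have -> : n%:Z - c%:Z = (n %/ d)%N%:Z * d%:Z.
  by rewrite {1}(divn_eq n d) -/c; lia.
by rewrite exprMn -[in LHS](subnK it) exprD; ring.
Qed.

(** * Uniform Euclidean algorithm on matrices *)

Definition epp_mx r m (A : nat -> 'M[int]_(r, m)) : Prop :=
  forall i j, epp (fun n => A n i j).

Lemma epp_sum (I : Type) (s : seq I) (F : I -> nat -> int) :
  (forall i, epp (F i)) -> epp (fun n => \sum_(i <- s) F i n).
Proof.
move=> eF; elim: s => [|i s IH].
  by apply: epp_eq (epp_const 0) => n; rewrite big_nil.
by apply: epp_eq (epp_add (eF i) IH) => n; rewrite big_cons.
Qed.

Lemma epp_mx_mul r m p (A : nat -> 'M[int]_(r, m)) (B : nat -> 'M[int]_(m, p)) :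
  epp_mx A -> epp_mx B -> epp_mx (fun n => A n *m B n).
Proof.
move=> eA eB i j.
apply: (epp_eq (f := fun n => \sum_k A n i k * B n k j)).
  by move=> n; rewrite mxE.
by apply: epp_sum => k; apply: epp_mul.
Qed.

Lemma epp_mx_add r m (A B : nat -> 'M[int]_(r, m)) :
  epp_mx A -> epp_mx B -> epp_mx (fun n => A n + B n).
Proof.
by move=> eA eB i j; apply: epp_eq (epp_add (eA i j) (eB i j)) => n; rewrite mxE.
Qed.

Lemma epp_mx_opp r m (A : nat -> 'M[int]_(r, m)) :
  epp_mx A -> epp_mx (fun n => - A n).
Proof. by move=> eA i j; apply: epp_eq (epp_opp (eA i j)) => n; rewrite mxE. Qed.

Lemma epp_mx_const r m (A : 'M[int]_(r, m)) : epp_mx (fun=> A).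
Proof. by move=> i j; apply: epp_const. Qed.

Lemma epp_mx_scalar r f : epp f -> epp_mx (fun n => (f n)%:M : 'M_r).
Proof.
move=> ef i j; apply: epp_eq (epp_mul ef (epp_const (i == j)%:R)) => n.
by rewrite mxE mulr_natr.
Qed.

Lemma epp_mx_row r m1 m2 (A : nat -> 'M[int]_(r, m1)) (B : nat -> 'M[int]_(r, m2)) :
  epp_mx A -> epp_mx B -> epp_mx (fun n => row_mx (A n) (B n)).
Proof.
move=> eA eB i j; case: (split_ordP j) => j' ->.
  by apply: epp_eq (eA i j') => n; rewrite row_mxEl.
by apply: epp_eq (eB i j') => n; rewrite row_mxEr.
Qed.

Lemma epp_mx_tr r m (A : nat -> 'M[int]_(r, m)) :
  epp_mx A -> epp_mx (fun n => (A n)^T).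
Proof. by move=> eA i j; apply: epp_eq (eA j i) => n; rewrite mxE. Qed.

Lemma epp_mx_col r1 r2 m (A : nat -> 'M[int]_(r1, m)) (B : nat -> 'M[int]_(r2, m)) :
  epp_mx A -> epp_mx B -> epp_mx (fun n => col_mx (A n) (B n)).
Proof.
move=> eA eB i j; have e := epp_mx_row (epp_mx_tr eA) (epp_mx_tr eB) j i.
by apply: epp_eq e => n; rewrite -tr_col_mx mxE.
Qed.

Lemma epp_mx_block r1 r2 m1 m2 (A : nat -> 'M[int]_(r1, m1))
    (B : nat -> 'M[int]_(r1, m2)) (C : nat -> 'M[int]_(r2, m1))
    (D : nat -> 'M[int]_(r2, m2)) :
  epp_mx A -> epp_mx B -> epp_mx C -> epp_mx D ->
  epp_mx (fun n => block_mx (A n) (B n) (C n) (D n)).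
Proof. by move=> eA eB eC eD; apply: epp_mx_col; apply: epp_mx_row. Qed.

Lemma epp_mx_usub r1 r2 m (A : nat -> 'M[int]_(r1 + r2, m)) :
  epp_mx A -> epp_mx (fun n => usubmx (A n)).
Proof. by move=> eA i j; apply: epp_eq (eA (lshift r2 i) j) => n; rewrite mxE. Qed.

Lemma epp_mx_dsub r1 r2 m (A : nat -> 'M[int]_(r1 + r2, m)) :
  epp_mx A -> epp_mx (fun n => dsubmx (A n)).
Proof. by move=> eA i j; apply: epp_eq (eA (rshift r1 i) j) => n; rewrite mxE. Qed.

Lemma epp_mx_lsub r1 r2 m (A : nat -> 'M[int]_(m, r1 + r2)) :
  epp_mx A -> epp_mx (fun n => lsubmx (A n)).
Proof. by move=> eA i j; apply: epp_eq (eA i (lshift r2 j)) => n; rewrite mxE. Qed.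

Lemma epp_mx_rsub r1 r2 m (A : nat -> 'M[int]_(m, r1 + r2)) :
  epp_mx A -> epp_mx (fun n => rsubmx (A n)).
Proof. by move=> eA i j; apply: epp_eq (eA i (rshift r1 j)) => n; rewrite mxE. Qed.

Lemma epp_mx_if0 r m f (A B : nat -> 'M[int]_(r, m)) :
  epp f -> epp_mx A -> epp_mx B ->
  epp_mx (fun n => if f n == 0 then A n else B n).
Proof.
move=> ef eA eB i j; apply: epp_eq (epp_if0 ef (eA i j) (eB i j)) => n.
by case: ifP.
Qed.

(** The inverse is carried along because it enters the unimodular multiplier and must be piecewise
    polynomial too. The gcd [h] needs no function of its own: it can be read off a matrix
    product. *)
Definition bezout_reducible (f g : nat -> int) : Prop :=
  exists ST : nat -> 'M[int]_(1 + 1) * 'M[int]_(1 + 1),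
    [/\ epp_mx (fun n => (ST n).1), epp_mx (fun n => (ST n).2) &
        eventually (fun n => (ST n).2 *m (ST n).1 = 1%:M /\
          exists2 h : int, 0 <= h &
            (ST n).1 *m col_mx (f n)%:M (g n)%:M = col_mx h%:M 0)].

Lemma bezout_reducible_mul (A A' : nat -> 'M[int]_(1 + 1)) f g f' g' :
  epp_mx A -> epp_mx A' -> (forall n, A' n *m A n = 1%:M) ->
  eventually (fun n => A n *m col_mx (f n)%:M (g n)%:M =
                       col_mx (f' n)%:M (g' n)%:M) ->
  bezout_reducible f' g' -> bezout_reducible f g.
Proof.
move=> eA eA' AA fg [ST [eS eT H]].
exists (fun n => ((ST n).1 *m A n, A' n *m (ST n).2)); split=> /=.
- exact: epp_mx_mul.
- exact: epp_mx_mul.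
- apply: eventually_mono (eventually_and fg H) => n [fgn [TS [h h0 Sh]]].
  split; last by exists h => //; rewrite -mulmxA fgn.
  by rewrite mulmxA -(mulmxA (A' n)) TS mulmx1.
Qed.

Lemma bezout_reducible_eventually_eq f g f' g' :
  eventually (fun n => f n = f' n) -> eventually (fun n => g n = g' n) ->
  bezout_reducible f' g' -> bezout_reducible f g.
Proof.
move=> ff gg; apply: (@bezout_reducible_mul (fun=> 1%:M) (fun=> 1%:M)).
- exact: epp_mx_const.
- exact: epp_mx_const.
- by move=> n; rewrite mulmx1.
- by apply: eventually_mono (eventually_and ff gg) => n [-> ->]; rewrite mul1mx.
Qed.

Lemma bezout_reducible_swap f g : bezout_reducible g f -> bezout_reducible f g.
Proof.
pose A : 'M[int]_(1 + 1) := block_mx 0 1%:M 1%:M 0.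
apply: (@bezout_reducible_mul (fun=> A) (fun=> A)).
- exact: epp_mx_const.
- exact: epp_mx_const.
- by move=> n; rewrite /A mulmx_block !(mul0mx, mulmx0, mul1mx, add0r, addr0) -scalar_mx_block.
- apply: eventually_all => n.
  by rewrite /A mul_block_col !(mul0mx, mul1mx, add0r, addr0).
Qed.

Lemma bezout_reducible_sub f g q :
  epp q -> bezout_reducible (fun n => f n - q n * g n) g -> bezout_reducible f g.
Proof.
move=> eq.
pose A n : 'M[int]_(1 + 1) := block_mx 1%:M (- q n)%:M 0 1%:M.
pose A' n : 'M[int]_(1 + 1) := block_mx 1%:M (q n)%:M 0 1%:M.
apply: (@bezout_reducible_mul A A').
- apply: epp_mx_block; try exact: epp_mx_const.
  by apply: epp_mx_scalar; apply: epp_opp.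
- by apply: epp_mx_block; try exact: epp_mx_const; apply: epp_mx_scalar.
- move=> n; rewrite /A /A' mulmx_block !(mul0mx, mulmx0, mul1mx, mulmx1, add0r, addr0).
  by rewrite -raddfD/= addNr raddf0 -scalar_mx_block.
- apply: eventually_all => n.
  rewrite /A mul_block_col !(mul0mx, mul1mx, add0r, addr0) -scalar_mxM.
  by rewrite -raddfD/= mulNr.
Qed.

(** Gluing: at n one takes the matrices of its residue class, evaluated at the position n / d. *)
Lemma bezout_reducible_split f g d : (0 < d)%N ->
  (forall c : 'I_d, bezout_reducible (fun k => f (d * k + c)%N)
                                     (fun k => g (d * k + c)%N)) ->
  bezout_reducible f g.
Proof.
move=> d0 /fin_all_exists[ST H].
pose c_ n : 'I_d := Ordinal (ltn_pmod n d0).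
have c_E k (c : 'I_d) : c_ (d * k + c)%N = c.
  by apply: val_inj; rewrite /= mulnC modnMDl modn_small.
have divE k (c : 'I_d) : ((d * k + c) %/ d = k)%N.
  by rewrite mulnC divnMDl// divn_small ?addn0.
exists (fun n => ST (c_ n) (n %/ d)%N); split.
- move=> i j; apply: (EppSplit d0) => c; have [eS _ _] := H c.
  by apply: epp_eq (eS i j) => k; rewrite c_E divE.
- move=> i j; apply: (EppSplit d0) => c; have [_ eT _] := H c.
  by apply: epp_eq (eT i j) => k; rewrite c_E divE.
- apply: (eventually_split d0) => c; have [_ _] := H c.
  by apply: eventually_mono => k; rewrite c_E divE.
Qed.

(** Agrees with [sgz (f n)] except at zeros of f, where it is 1 and thus still a unit. *)
Lemma epp_sign f : epp f -> epp (fun n => (-1) ^+ (f n < 0)%R).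
Proof.
move=> ef; apply: epp_eq (epp_if0 (epp_sgz ef) (epp_const 1) (epp_sgz ef)) => n.
rewrite sgz_eq0 sgz_def; have [->|fn0] := eqVneq (f n) 0; first by rewrite ltxx.
by rewrite mulr1n.
Qed.

Lemma bezout_reducible0 f : epp f -> bezout_reducible f (fun=> 0).
Proof.
move=> ef; pose A n : 'M[int]_(1 + 1) := ((-1) ^+ (f n < 0)%R)%:M.
have eA : epp_mx A by apply: epp_mx_scalar; apply: epp_sign.
exists (fun n => (A n, A n)); split=> //=.
apply: eventually_all => n; split.
  by rewrite -scalar_mxM -expr2 sqrr_sign.
exists `|f n| => //; rewrite mul_scalar_mx scale_col_mx.
by rewrite !scale_scalar_mx mulr0 raddf0 normrEsign.
Qed.

(** Outer induction on the sum of the sizes, inner induction on |lc Q|. For unequal degrees, leading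
    term elimination on residue classes lowers the sum; for equal degrees, division of leading
    coefficients lowers the sum or the leading coefficient. *)
Lemma bezout_reducible_horner (P Q : {poly int}) :
  bezout_reducible (fun n => P.[n%:Z]) (fun n => Q.[n%:Z]).
Proof.
have [s] := ubnP (size P + size Q); elim: s P Q => // s IHs P Q.
have [l] := ubnP `|lead_coef Q|%N; elim: l P Q => // l IHl P Q.
rewrite !ltnS => lQ sPQ.
have [->|Q0] := eqVneq Q 0.
  apply: bezout_reducible_eventually_eq (bezout_reducible0 (epp_horner P)).
    exact: eventually_all.
  by apply: eventually_all => n; rewrite horner0.
have [->|P0] := eqVneq P 0.
  apply: bezout_reducible_swap.
  apply: bezout_reducible_eventually_eq (bezout_reducible0 (epp_horner Q)).
    exact: eventually_all.
  by apply: eventually_all => n; rewrite horner0.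
have elim_lead (P1 Q1 : {poly int}) : Q1 != 0 -> (size Q1 < size P1)%N ->
    (size P1 + size Q1 <= s)%N ->
    bezout_reducible (fun n => P1.[n%:Z]) (fun n => Q1.[n%:Z]).
  move=> Q10 sQP1 sPQ1.
  have e0 : (0 < `|lead_coef Q1|)%N by rewrite absz_gt0 lead_coef_eq0.
  apply: (@bezout_reducible_split _ _ _ e0) => c.
  have [q] := lead_term_elim c Q10 sQP1.
  set A := progression _ c; set P1' := _ - _ => sP1'.
  apply: (bezout_reducible_sub (epp_horner q)).
  apply: (@bezout_reducible_eventually_eq _ _ (fun k => P1'.[k%:Z])
    (fun k => (Q1 \Po A).[k%:Z])).
  - apply: eventually_all => k; rewrite /P1' hornerD hornerN hornerM.
    by rewrite !horner_progression.
  - by apply: eventually_all => k; rewrite horner_progression.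
  - by apply: IHs; rewrite size_comp_progression//; lia.
have [sPQ'|sPQ'|sPQ'] := ltngtP (size P) (size Q).
- by apply: bezout_reducible_swap; apply: elim_lead => //; rewrite addnC.
- exact: elim_lead.
have [|q [R [PE HR]]] := @lead_coef_divz P Q Q0; first by rewrite sPQ'.
apply: (bezout_reducible_sub (epp_const q)).
apply: (@bezout_reducible_eventually_eq _ _ (fun k => R.[k%:Z])
    (fun k => Q.[k%:Z])).
- by apply: eventually_all => k; rewrite PE hornerD hornerZ addrC addKr.
- exact: eventually_all.
case: HR => [sR|[sR /andP[lR0 lRQ]]]; first by apply: IHs; lia.
(* The sizes are unchanged, but the swap puts R second, with lc R < |lc Q|. *)
apply: bezout_reducible_swap; apply: IHl; last by rewrite ltnS addnC sR; lia.
suff aux (x y : int) : 0 < x -> x < `|y| -> (`|y| <= l)%N -> (`|x| < l)%N.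
  exact: aux lR0 lRQ lQ.
by lia.
Qed.

Lemma epp_bezout f g : epp f -> epp g -> bezout_reducible f g.
Proof.
move: f g; apply: epp_ind2 => [f g d d0 H|f g P Q fP gQ].
  exact: (bezout_reducible_split d0).
exact: bezout_reducible_eventually_eq fP gQ (bezout_reducible_horner P Q).
Qed.

(** Induction on the height: the tail is reduced to a single entry, which a Bezout matrix then
    combines with the top entry. *)
Lemma epp_column_reduction r (c : nat -> 'cV[int]_(1 + r)) : epp_mx c ->
  exists S T : nat -> 'M[int]_(1 + r),
    [/\ epp_mx S, epp_mx T &
        eventually (fun n => T n *m S n = 1%:M /\
          exists2 h : int, 0 <= h & S n *m c n = col_mx h%:M 0)].
Proof.
elim: r c => [|r IH] c ec.
  pose A n : 'M[int]_(1 + 0) := ((-1) ^+ (c n 0 0 < 0)%R)%:M.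
  have eA : epp_mx A by apply: epp_mx_scalar; apply: epp_sign.
  exists A, A; split=> //; apply: eventually_all => n; split.
    by rewrite -scalar_mxM -expr2 sqrr_sign.
  exists `|c n 0 0| => //; rewrite mul_scalar_mx; apply/matrixP => i j.
  rewrite (ord1 j) (ord1 i) !mxE; case: splitP => [k _|[]//].
  by rewrite mxE (ord1 k) eqxx mulr1n normrEsign.
have [S' [T' [eS' eT' H']]] := IH (fun n => dsubmx (c n)) (epp_mx_dsub ec).
(* The gcd of the tail as an explicit piecewise polynomial function; [H'] provides it only
   pointwise, for large n. *)
pose g n := (S' n *m dsubmx (c n)) 0 0.
have eg : epp g by apply: epp_mx_mul => //; apply: epp_mx_dsub.
have [ST [eS eT H]] := epp_bezout (ec 0 0) eg.
pose X n : 'M[int]_(1 + (1 + r)) := block_mx (ST n).1 0 0 (1%:M : 'M_r).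
pose Y n : 'M[int]_(1 + (1 + r)) := block_mx (ST n).2 0 0 (1%:M : 'M_r).
pose X' n : 'M[int]_(1 + (1 + r)) := block_mx 1%:M 0 0 (S' n).
pose Y' n : 'M[int]_(1 + (1 + r)) := block_mx 1%:M 0 0 (T' n).
exists (fun n => X n *m X' n), (fun n => Y' n *m Y n); split.
- apply: epp_mx_mul; last by apply: epp_mx_block => //; apply: epp_mx_const.
  by apply: (@epp_mx_block 2 r 2 r) => //; apply: epp_mx_const.
- apply: epp_mx_mul; first by apply: epp_mx_block => //; apply: epp_mx_const.
  by apply: (@epp_mx_block 2 r 2 r) => //; apply: epp_mx_const.
apply: eventually_mono (eventually_and H H') => n [[TS [h h0 Sh]] [TS' [h' h'0 Sh']]].
split.
  have YX : Y n *m X n = 1%:M.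
    rewrite /X /Y (@mulmx_block _ 2 r 2 r 2 r) TS !(mul0mx, mulmx0, mulmx1, addr0, add0r).
    by rewrite -scalar_mx_block.
  rewrite mulmxA -(mulmxA (Y' n)) YX mulmx1 mulmx_block TS'.
  by rewrite !(mul0mx, mulmx0, mulmx1, addr0, add0r) -scalar_mx_block.
exists h => //; rewrite -mulmxA -{1}[c n]vsubmxK mul_block_col.
rewrite !(mul0mx, mul1mx, addr0, add0r) Sh'.
have -> : usubmx (c n) = (c n 0 0)%:M.
  apply/matrixP => i j; rewrite !ord1 !mxE eqxx mulr1n; congr (c n _ _).
  exact: val_inj.
have gh : g n = h'.
  rewrite /g Sh' mxE; case: splitP => [k _|//].
  by rewrite mxE (ord1 k).
(* Regrouping 1 + (1 + r) as (1 + 1) + r lets the Bezout matrix act on the two top entries. *)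
have -> : col_mx (c n 0 0)%:M (col_mx h'%:M (0 : 'cV_r)) =
  col_mx (col_mx (c n 0 0)%:M (g n)%:M) 0 :> 'cV_((1 + 1) + r).
  by rewrite gh col_mxA castmx_id.
rewrite /X (@mul_block_col _ 2 r 2 r 1) Sh !(mul0mx, mulmx0, addr0, add0r).
have := @col_mxA _ 1 1 r 1 h%:M 0 0.
by rewrite /= castmx_id col_mx0 => ->.
Qed.

(** * Hermite forms *)

Definition reduced_mod (s r m : nat) (W : 'M[int]_(s, m)) (B : 'M[int]_(r, m)) :=
  forall i j, pivot B i j -> forall k, 0 <= W k j < B i j.

Lemma pivot_row_mx0 r m (B : 'M[int]_(r, m)) i j :
  pivot (row_mx (0 : 'M_(r, 1)) B) i j <->
  exists2 j', j = rshift 1 j' & pivot B i j'.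
Proof.
split=> [[]|[j' -> [nz z]]]; last first.
  split; first by rewrite row_mxEr.
  move=> k; case: (split_ordP k) => k' ->; first by rewrite row_mxEl mxE.
  by rewrite row_mxEr ltn_add2l; apply: z.
case: (split_ordP j) => j' ->; first by rewrite row_mxEl mxE eqxx.
rewrite row_mxEr => nz z; exists j' => //; split=> // k kj.
by rewrite -(z (rshift 1 k)) ?row_mxEr//= ltn_add2l.
Qed.

Lemma hermite_echelon_row_mx0 r m (B : 'M[int]_(r, m)) :
  hermite_echelon_form B -> hermite_echelon_form (row_mx (0 : 'M_(r, 1)) B).
Proof.
move=> [stair red]; split=> [i i' j ii' /pivot_row_mx0[j' -> p]|i j].
  have [k kj pk] := stair _ _ _ ii' p.
  exists (rshift 1 k); first by rewrite ltn_add2l.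
  by apply/pivot_row_mx0; exists k.
move=> /pivot_row_mx0[j' -> /red[B0 lt]].
by rewrite row_mxEr; split=> // i' /lt; rewrite row_mxEr.
Qed.

Lemma reduced_mod_row_mx0 s r m (W : 'M[int]_(s, 1 + m)) (B : 'M[int]_(r, m)) :
  reduced_mod (rsubmx W) B -> reduced_mod W (row_mx (0 : 'M_(r, 1)) B).
Proof.
move=> red i j /pivot_row_mx0[j' -> /red + k] => /(_ k).
by rewrite row_mxEr mxE.
Qed.

Lemma pivot_block_mx r m (h : int) (t : 'rV[int]_m) (B : 'M[int]_(r, m)) i j :
  h != 0 ->
  pivot (block_mx (h%:M : 'M_1) t 0 B) i j <->
  (i = lshift r ord0 /\ j = lshift m ord0) \/
  (exists i' j', [/\ i = rshift 1 i', j = rshift 1 j' & pivot B i' j']).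
Proof.
move=> h0; split=> [[]|[[-> ->]|[i' [j' [-> -> [nz z]]]]]]; last 2 first.
- split=> // ; by rewrite block_mxEul mxE.
- split; first by rewrite block_mxEdr.
  move=> k; case: (split_ordP k) => k' ->; first by rewrite block_mxEdl mxE.
  by rewrite block_mxEdr ltn_add2l; apply: z.
case: (split_ordP i) (split_ordP j) => i' -> [] j' -> nz z.
- by left; rewrite !ord1.
- have := z (lshift m ord0) (ltn0Sn _).
  by rewrite ord1 block_mxEul mxE eqxx mulr1n => /eqP; rewrite (negPf h0).
- by rewrite block_mxEdl mxE eqxx in nz.
- right; exists i', j'; split=> //; rewrite block_mxEdr in nz; split=> // k kj.
  by rewrite -(z (rshift 1 k)) ?block_mxEdr//= ltn_add2l.
Qed.

(** The new pivot has only zeros below it; the only new entries above old pivots are those of [t],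
    and [reduced_mod t B] bounds them. *)
Lemma hermite_echelon_block_mx r m (h : int) (t : 'rV[int]_m)
    (B : 'M[int]_(r, m)) :
  0 < h -> reduced_mod t B -> hermite_echelon_form B ->
  hermite_echelon_form (block_mx (h%:M : 'M_1) t 0 B).
Proof.
move=> h0 redt [stair red]; have hn0 : h != 0 by rewrite gt_eqF.
split=> [i i' j ii' /(pivot_block_mx _ _ _ _ hn0)[[i0 _]|]|i j].
- by rewrite i0 in ii'.
- move=> [k [l [i'k -> p]]]; rewrite i'k in ii' *.
  case: (split_ordP i) ii' => i1 -> ii'.
    exists (lshift m ord0) => //; apply/pivot_block_mx => //; left.
    by rewrite ord1.
  rewrite ltn_add2l in ii'; have [q ql pq] := stair _ _ _ ii' p.
  exists (rshift 1 q); first by rewrite ltn_add2l.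
  by apply/pivot_block_mx => //; right; exists i1, q.
- move=> /(pivot_block_mx _ _ _ _ hn0)[[-> ->]|[k [l [-> -> p]]]].
    rewrite block_mxEul mxE eqxx mulr1n; split=> // i'.
    case: (split_ordP i') => i1 ->; first by rewrite ord1 eqxx.
    by rewrite block_mxEdl mxE h0 lexx.
  have [B0 lt] := red _ _ p; rewrite block_mxEdr; split=> // i'.
  case: (split_ordP i') => i1 -> i1k; first by rewrite block_mxEur redt.
  by rewrite block_mxEdr lt//; apply: contra_neq i1k => ->.
Qed.

Lemma reduced_mod_block_mx s r m (h : int) (t : 'rV[int]_m)
    (B : 'M[int]_(r, m)) (W : 'M[int]_(s, 1 + m)) : h != 0 ->
  (forall k, 0 <= W k (lshift m ord0) < h) -> reduced_mod (rsubmx W) B ->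
  reduced_mod W (block_mx (h%:M : 'M_1) t 0 B).
Proof.
move=> h0 Wh red i j /(pivot_block_mx _ _ _ _ h0)[[-> ->]|[k [l [-> -> p]]]] q.
  by rewrite block_mxEul mxE eqxx mulr1n.
by rewrite block_mxEdr; have := red _ _ p q; rewrite mxE.
Qed.

(** [X] holds the quotients of the reduction of [W] modulo the rows of [B]. They are recorded
    because part of them enters the multiplier at the next stage. *)
Definition hermite_reduction (r s m : nat) (U : 'M[int]_r) (X : 'M[int]_(s, r))
    (B M : 'M[int]_(r, m)) (W : 'M[int]_(s, m)) : Prop :=
  [/\ U \in unitmx, hermite_echelon_form B, M = U *m B &
      reduced_mod (W - X *m B) B].

Lemma hermite_reduction_row_mx0 r s m (U : 'M[int]_r) (X : 'M[int]_(s, r))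
    (B : 'M[int]_(r, m)) (M : 'M[int]_(r, 1 + m)) (W : 'M[int]_(s, 1 + m)) :
  lsubmx M = 0 -> hermite_reduction U X B (rsubmx M) (rsubmx W) ->
  hermite_reduction U X (row_mx (0 : 'M_(r, 1)) B) M W.
Proof.
move=> M0 [uU eB ME red]; split=> //.
- exact: hermite_echelon_row_mx0.
- by rewrite mul_mx_row mulmx0 -ME -{1}[M]hsubmxK M0.
- by apply: reduced_mod_row_mx0; rewrite raddfB/= mul_mx_row row_mxKr.
Qed.

(** Here S M has rows (h, v) and (0, U B). With X_d the lower part of X and t = v - X_d B, it
    factors as [1, X_d; 0, U] [h, t; 0, B], and T = S^-1 recovers M. *)
Lemma hermite_reduction_block_mx r s m (S T : 'M[int]_(1 + r)) (h : int)
    (U : 'M[int]_r) (X : 'M[int]_(s + 1, r)) (B : 'M[int]_(r, m))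
    (M : 'M[int]_(1 + r, 1 + m)) (W : 'M[int]_(s, 1 + m)) :
  T *m S = 1%:M -> 0 < h -> S *m lsubmx M = col_mx h%:M 0 ->
  let N := S *m rsubmx M in let v := usubmx N in
  let x := map_mx (divz^~ h) (lsubmx W) in
  hermite_reduction U X B (dsubmx N) (col_mx (rsubmx W - x *m v) v) ->
  hermite_reduction (T *m block_mx (1%:M : 'M_1) (dsubmx X) 0 U)
    (row_mx x (usubmx X + x *m dsubmx X))
    (block_mx (h%:M : 'M_1) (v - dsubmx X *m B) 0 B) M W.
Proof.
move=> TS h0 Sh N v x [uU eB NE]; have [uT _] := mulmx1_unit TS.
rewrite -{1}[X]vsubmxK mul_col_mx opp_col_mx add_col_mx => red.
have hn0 : h != 0 by rewrite gt_eqF.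
split.
- by rewrite unitmx_mul uT unitmxE det_ublock det1 mul1r.
- apply: hermite_echelon_block_mx => // i j p k.
  by have := red i j p (rshift s k); rewrite col_mxEd.
- rewrite -mulmxA mulmx_block !(mul0mx, mulmx0, mul1mx, add0r, addr0).
  rewrite -NE subrK -[M in LHS]mul1mx -TS -mulmxA; congr (_ *m _).
  rewrite -{1}[M]hsubmxK mul_mx_row Sh -/N -{1}[N]vsubmxK -/v.
  by rewrite block_mxEv -block_mxEh.
rewrite mul_row_block mulmx0 addr0.
apply: reduced_mod_block_mx => // [k|].
  (* In the first column [x] holds the floor quotients by h, so residues modulo h remain. *)
  rewrite mxE [X in _ + X]mxE row_mxEl mul_mx_scalar.
  rewrite [X in _ - X]mxE [X in _ - _ * X]mxE mxE mulrC.
  have -> : W k (lshift m ord0) - (W k (lshift m ord0) %/ h)%Z * h =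
            (W k (lshift m ord0) %% h)%Z.
    by rewrite /modz.
  by rewrite modz_ge0// ltz_pmod.
(* Substituting t = v - X_d B, the terms x X_d B cancel, leaving the upper rows that [red] already
   bounds. *)
rewrite raddfB/= row_mxKr mulmxBr mulmxDl mulmxA [usubmx X *m B + _]addrC.
rewrite addrA subrK opprD addrA => i j p k.
by have := red i j p (lshift 1 k); rewrite col_mxEu.
Qed.

(* Carrying extra rows [W], to be reduced modulo the rows of [M], makes the
   induction on the number of columns handle the entries above the pivots: once
   the first column is cleared, the top row of [M] becomes one of these rows. *)
Lemma epp_hermite_echelon m r s (M : nat -> 'M[int]_(r, m))
    (W : nat -> 'M[int]_(s, m)) : epp_mx M -> epp_mx W ->
  exists (U : nat -> 'M[int]_r) (X : nat -> 'M[int]_(s, r))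
         (B : nat -> 'M[int]_(r, m)),
    [/\ epp_mx U, epp_mx X, epp_mx B &
        eventually (fun n => hermite_reduction (U n) (X n) (B n) (M n) (W n))].
Proof.
elim: m r s M W => [|m IH] r s M W eM eW.
  exists (fun=> 1%:M), (fun=> 0), M; split=> //; try exact: epp_mx_const.
  apply: eventually_all => n; split; rewrite ?unitmx1 ?mul1mx//; last by move=> i [].
  by split=> [i i' []|i []].
case: r M eM => [|r] M eM.
  exists (fun=> 1%:M), (fun=> 0), M; split=> //; try exact: epp_mx_const.
  apply: eventually_all => n; split; rewrite ?unitmx1 ?mul1mx//; last by case.
  by split; case.
change 'M[int]_(s, m.+1) with 'M[int]_(s, 1 + m) in W.
change 'M[int]_(r.+1, m.+1) with 'M[int]_(1 + r, 1 + m) in M.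
change (@epp_mx s (1 + m) W) in eW; change (@epp_mx (1 + r) (1 + m) M) in eM.
have [S [T [eS eT HST]]] := epp_column_reduction (epp_mx_lsub eM).
pose h n := (S n *m lsubmx (M n)) ord0 ord0.
have eh : epp h by apply: epp_mx_mul => //; apply: epp_mx_lsub.
pose N n : 'M[int]_(1 + r, m) := S n *m rsubmx (M n).
have eN : epp_mx N by apply: epp_mx_mul => //; apply: epp_mx_rsub.
pose v n := usubmx (N n).
have ev : epp_mx v by apply: epp_mx_usub.
pose x n : 'M[int]_(s, 1) := map_mx (divz^~ (h n)) (lsubmx (W n)).
have ex : epp_mx x.
  move=> i j; apply: epp_eq (epp_divz (epp_mx_lsub eW i j) eh) => n.
  by rewrite [RHS]mxE.
have eW1 : epp_mx (fun n => rsubmx (W n)) by apply: epp_mx_rsub.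
(* The first column may vanish for some large n and not for others, so both recursions are prepared
   for all n: here 1 + r rows without that column, below the r rows under the new pivot. The choice
   is made pointwise by h(n) = 0. *)
have [U1 [X1 [B1 [eU1 eX1 eB1 H1]]]] :=
  IH _ _ (fun n => rsubmx (M n)) (fun n => rsubmx (W n)) (epp_mx_rsub eM) eW1.
have eW2 : epp_mx (fun n => col_mx (rsubmx (W n) - x n *m v n) (v n)).
  apply: epp_mx_col => //; apply: epp_mx_add => //.
  by apply: epp_mx_opp; apply: epp_mx_mul.
have [U2 [X2 [B2 [eU2 eX2 eB2 H2]]]] :=
  IH _ _ (fun n => dsubmx (N n)) _ (epp_mx_dsub eN) eW2.
pose t n := v n - dsubmx (X2 n) *m B2 n.
have et : epp_mx t.
  apply: epp_mx_add => //; apply: epp_mx_opp; apply: epp_mx_mul => //.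
  exact: epp_mx_dsub.
pose U n := if h n == 0 then U1 n
  else T n *m block_mx (1%:M : 'M_1) (dsubmx (X2 n)) 0 (U2 n).
pose X n := if h n == 0 then X1 n
  else row_mx (x n) (usubmx (X2 n) + x n *m dsubmx (X2 n)).
pose B n := if h n == 0 then row_mx (0 : 'M_(1 + r, 1)) (B1 n)
  else block_mx ((h n)%:M : 'M_1) (t n) 0 (B2 n).
exists U, X, B; split.
- apply: epp_mx_if0 => //; apply: epp_mx_mul => //.
  apply: (@epp_mx_block 1 r 1 r) => //; try exact: epp_mx_const.
  exact: epp_mx_dsub.
- apply: epp_mx_if0 => //; apply: (@epp_mx_row s 1 r) => //.
  apply: epp_mx_add; first exact: epp_mx_usub.
  by apply: epp_mx_mul => //; apply: epp_mx_dsub.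
- apply: epp_mx_if0 => //; first by apply: (@epp_mx_row (1 + r) 1 m) => //; apply: epp_mx_const.
  by apply: (@epp_mx_block 1 r 1 m) => //; [apply: epp_mx_scalar|apply: epp_mx_const].
apply: eventually_mono (eventually_and HST (eventually_and H1 H2)).
move=> n [[TS [h' h'0 Sh]] [red1 red2]].
have hE : h n = h'.
  rewrite /h Sh mxE; case: splitP => [k _|//].
  by rewrite mxE (ord1 k).
rewrite -hE in h'0 Sh; rewrite /U /X /B; have [hn0|hn0] := eqVneq (h n) 0.
  apply: hermite_reduction_row_mx0 => //.
  by rewrite -[lsubmx _]mul1mx -TS -mulmxA Sh hn0 raddf0 col_mx0 mulmx0.
by apply: hermite_reduction_block_mx => //; rewrite lt_def hn0.
Qed.

(** * Full column rank *)

Lemma pivot_exists r m (B : 'M[int]_(r, m)) i j :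
  B i j != 0 -> exists2 j' : 'I_m, (j' <= j)%N & pivot B i j'.
Proof.
move=> Bij.
have [k Bik kmin] := @arg_minnP _ j (fun k => B i k != 0) (@nat_of_ord m) Bij.
exists k; first exact: kmin.
split=> // l lk; apply/eqP/negPn/negP => /kmin.
by rewrite leqNgt lk.
Qed.

(** Each of the i rows above has a pivot, and these lie in distinct columns to the left of j. *)
Lemma hermite_echelon_pivot_ge r m (B : 'M[int]_(r, m)) (i : 'I_r) (j : 'I_m) :
  hermite_echelon_form B -> pivot B i j -> (i <= j)%N.
Proof.
move=> [stair _]; case: i j => i; elim: i => // i IH ir j p.
have [k kj pk] := stair (Ordinal (ltnW ir)) (Ordinal ir) j (ltnSn i) p.
exact: leq_ltn_trans (IH _ _ pk) kj.
Qed.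

Lemma hermite_echelon_trig r m (B : 'M[int]_(r, m)) (i : 'I_r) (j : 'I_m) :
  hermite_echelon_form B -> (j < i)%N -> B i j = 0.
Proof.
move=> eB ji; apply/eqP/negPn/negP => /pivot_exists[k kj].
by move=> /(hermite_echelon_pivot_ge eB); rewrite leqNgt (leq_ltn_trans kj).
Qed.

(* If the k-th diagonal entry vanished, the first k+1 columns would vanish
   below row k, hence would have rank at most k. *)
Lemma hermite_echelon_diag r m (B : 'M[int]_(r, m)) (k : 'I_m) :
  hermite_echelon_form B -> full_column_rank B ->
  exists2 i : 'I_r, i = k :> nat & B i k != 0.
Proof.
move=> eB rB; have : row_full (map_mx (intr : int -> rat) B) by apply/eqP.
move=> /row_fullP[L LB].
have rm : (m <= r)%N by apply: mulmx1_min LB.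
have kr : (k <= r)%N by rewrite (leq_trans _ rm)// ltnW.
pose i := Ordinal (leq_trans (ltn_ord k) rm); exists i => //.
apply/negP => Bik.
(* A nonzero entry would give a pivot of row l in a column j' with k <= l <= j' <= j <= k, that is,
   at the vanishing diagonal entry. *)
have B0 (l : 'I_r) (j : 'I_m) : (k <= l)%N -> (j <= k)%N -> B l j = 0.
  move=> kl jk; apply/eqP/negPn/negP => /pivot_exists[j' j'j p].
  have lj' := hermite_echelon_pivot_ge eB p.
  have jE : j' = k by apply: val_inj => /=; lia.
  have lE : l = i by apply: val_inj => /=; lia.
  by case: p; rewrite jE lE (eqP Bik).
pose w := @widen_ord k.+1 m (ltn_ord k).
pose w' := @widen_ord k r kr.
(* The first k + 1 rows of the left inverse L and columns of B, with the summation cut down to k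
   indices, give an identity matrix of size k + 1. *)
have : (k.+1 <= k)%N.
  apply: (@mulmx1_min rat _ _ (\matrix_(a, b) L (w a) (w' b))
            (\matrix_(b, a) (B (w' b) (w a))%:~R)).
  apply/matrixP => a b; rewrite !mxE.
  have := congr1 (fun A : 'M_m => A (w a) (w b)) LB; rewrite !mxE.
  have -> : (w a == w b) = (a == b) by [].
  rewrite (bigID (fun l : 'I_r => (l < k)%N)) /= [X in _ + X]big1 ?addr0.
    by rewrite (big_ord_narrow kr) => <-; apply: eq_bigr => l _; rewrite !mxE.
  move=> l; rewrite -leqNgt => kl; rewrite mxE B0 ?mulr0//.
  by rewrite -ltnS; apply: (ltn_ord b).
by rewrite ltnn.
Qed.

(** Every diagonal entry is nonzero with zeros to its left, hence a pivot, so the bounds at pivots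
    become bounds at the diagonal. *)
Lemma hermite_normal_form_of_echelon r m (B : 'M[int]_(r, m)) :
  hermite_echelon_form B -> full_column_rank B -> hermite_normal_form B.
Proof.
move=> eB rB.
have diag (j : 'I_m) : exists2 k : 'I_r, k = j :> nat & 0 < B k j /\
    forall i, i != k -> 0 <= B i j < B k j.
  have [k kj Bkj] := hermite_echelon_diag j eB rB; exists k => //.
  case: (eB) => _ /(_ k j); apply; split=> // l lj.
  by apply: hermite_echelon_trig eB _; rewrite kj.
split.
- by move=> i j; apply: hermite_echelon_trig.
- move=> i j; have [k _ [B0 lt]] := diag j.
  have [->|/lt/andP[]//] := eqVneq i k; exact: ltW.
- move=> k j kj i; have [k' k'j [_ lt]] := diag j.
  have <- : k' = k by apply: val_inj; rewrite /= k'j.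
  have [->|/lt/andP[_ ltB]] := eqVneq i k'; first by rewrite lexx.
  by rewrite (ltW ltB).
Qed.

Lemma full_column_rank_mulr r m (U : 'M[int]_r) (B : 'M[int]_(r, m)) :
  full_column_rank (U *m B) -> full_column_rank B.
Proof.
rewrite /full_column_rank map_mxM => rUB; apply/eqP/row_fullP.
have /row_fullP[L LUB] : row_full (map_mx (intr : int -> rat) U *m map_mx intr B).
  exact/eqP.
by exists (L *m map_mx intr U); rewrite -mulmxA.
Qed.

Theorem corollary2p8 (r m : nat) (M : nat -> 'M[int]_(r, m))
    (hM : forall (i : 'I_r) (j : 'I_m), IQ (fun n => M n i j)) :
  exists (B : nat -> 'M[int]_(r, m)) (U : nat -> 'M[int]_r),
    [/\ forall (i : 'I_r) (j : 'I_m), eventually_IQ (fun n => B n i j),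
        forall i j : 'I_r, eventually_IQ (fun n => U n i j) &
        eventually (fun n =>
          [/\ U n \in unitmx,
              hermite_echelon_form (B n),
              full_column_rank (M n) -> hermite_normal_form (B n) &
              M n = U n *m B n])].
Proof.
have eM : epp_mx M by move=> i j; apply: epp_IQ.
(* At the outset there are no extra rows to reduce: [W] has height 0. *)
have [U [X [B [eU _ eB H]]]] :=
  epp_hermite_echelon eM (epp_mx_const (0 : 'M_(0, m))).
exists B, U; split.
- by move=> i j; apply: epp_eventually_IQ.
- by move=> i j; apply: epp_eventually_IQ.
apply: eventually_mono H => n [uU eBn MUB _]; split=> //.
rewrite MUB => /full_column_rank_mulr.
exact: hermite_normal_form_of_echelon.
Qed.
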